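(* For each continuous function $k:[0,\infty)\to\mathbb{R}$ there exists a continuous function $b:[0,\infty)\to\mathbb{R}$ such that the zero solution of $$u''(t)+b(t)u'(t)+k(t)u(t)=0,\qquad t\ge 0,$$ is stable (with initial time $t_0=0$). In fact, if $\alpha>1$ is a constant, then every continuous $b:[0,\infty)\to\mathbb{R}$ satisfying $$b(t)\ge 2|k(t)|(t+\alpha)^2+\frac{2}{t+\alpha}\quad\text{for all } t\ge 0$$ has this property.
   Context: With initial time $t_0=0$, the zero solution of the second-order equation is called stable if for each $\epsilon>0$ there exists $\delta>0$ such that every solution $u$ on $[0,\infty)$ with $u(0)^2+u'(0)^2<\delta^2$ satisfies $u(t)^2+u'(t)^2<\epsilon^2$ for all $t\ge 0$. *)

(* Defs.v *)
From Stdlib Require Import Reals.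
Open Scope R_scope.

(** Functions on [0, oo) are total functions [R -> R] of which only the values
    on [halfline] are ever used: continuity and derivatives are taken relative
    to [halfline], hence one-sided at 0. *)
Definition halfline (t : R) : Prop := 0 <= t.

Definition continuous_on_halfline (f : R -> R) : Prop :=
  forall t : R, 0 <= t -> continue_in f halfline t.

(** [du] is the derivative of [u]; its values on [halfline] are determined by
    [u], since [halfline] has no isolated point. *)
Definition is_solution (b k u du : R -> R) : Prop :=
  exists d2u : R -> R, forall t : R, 0 <= t ->
    D_in u du halfline t /\ D_in du d2u halfline t /\
    d2u t + b t * du t + k t * u t = 0.

Definition zero_solution_stable (b k : R -> R) : Prop :=
  forall eps : R, 0 < eps -> exists delta : R, 0 < delta /\
    forall u du : R -> R, is_solution b k u du ->
      u 0 ^ 2 + du 0 ^ 2 < delta ^ 2 ->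
      forall t : R, 0 <= t -> u t ^ 2 + du t ^ 2 < eps ^ 2.

(* Main.v *)
Require Import Defs.
From Stdlib Require Import Reals Lra Psatz.
From Coquelicot Require Import Coquelicot.
Open Scope R_scope.

(** Put [s = t + alpha] and [w = s^2 u'].  The equation becomes
    [w' = (2/s - b) w - k s^2 u], so the lower bound on [b] gives
    [w w' <= |k| s^2 |w| (|u| - 2 |w|)]: the damping prevents [|w|] from
    growing as long as [|u| <= 2 |w|].  Hence, if [|u| <= C] on [[0, T]], then
    [|w| <= max(|w(0)|, C/2)] there ([scaled_velocity_bound]).  Conversely
    [|w| <= M] means [|u'| <= M / s^2], and since the integral of [1 / s^2] is
    at most [1 / alpha < 1], this gives [|u| <= |u(0)| + M]
    ([position_bound]).

    Applied to the maximum [C] of [|u|] on [[0, T]], the two estimates give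
    [C <= |u(0)| + |w(0)| + C/2], so [C <= 2 (|u(0)| + |w(0)|)], a bound that
    does not depend on [T] ([a_priori_bound]).  Stability follows, because
    [|u'| <= |w|] and [w(0) = alpha^2 u'(0)].

    The existence of [b] is the case [alpha = 2] with equality in the
    condition on [b]. *)

(** * Functions on the half-line *)

(** Freezing a function at its value at 0 turns one-sided continuity at 0 into
    two-sided continuity, which the mean value theorem asks for. *)
Definition extend (f : R -> R) (t : R) : R := f (Rmax 0 t).

Lemma extend_eq (f : R -> R) (t : R) : 0 <= t -> extend f t = f t.
Proof. intros Ht; unfold extend; now rewrite Rmax_right. Qed.

Lemma extend_continuity (f : R -> R) :
  continuous_on_halfline f -> continuity (extend f).
Proof.
  intros Hf x e He.
  destruct (Hf (Rmax 0 x) (Rmax_l 0 x) e He) as [d [Hd Hclose]].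
  exists d; split; [exact Hd|]; intros y [_ Hy]; unfold extend.
  destruct (Req_dec (Rmax 0 x) (Rmax 0 y)) as [Heq|Hneq].
  - rewrite <- Heq; simpl; unfold Rdist.
    rewrite Rminus_diag, Rabs_R0; exact He.
  - apply Hclose; split.
    + split; [apply Rmax_l | exact Hneq].
    + simpl in *; unfold Rdist in *.
      apply Rle_lt_trans with (2 := Hy).
      unfold Rmax; repeat destruct Rle_dec; unfold Rabs;
        repeat destruct Rcase_abs; lra.
Qed.

Lemma continuity_continuous_on_halfline (f : R -> R) :
  continuity f -> continuous_on_halfline f.
Proof.
  intros Hf t Ht e He; destruct (Hf t e He) as [d [Hd Hclose]].
  exists d; split; [exact Hd|]; intros x [[_ Hx] Hxt].
  apply Hclose; repeat split; assumption.
Qed.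

Lemma D_in_continuous_on_halfline (f df : R -> R) :
  (forall t, 0 <= t -> D_in f df halfline t) -> continuous_on_halfline f.
Proof. intros Hf t Ht; now apply cont_deriv with df, Hf. Qed.

Lemma D_in_extend (f df : R -> R) (t : R) :
  0 < t -> D_in f df halfline t -> is_derive (extend f) t (df t).
Proof.
  intros Ht Hf; apply is_derive_Reals; intros e He.
  destruct (Hf e He) as [d [Hd Hclose]].
  assert (Hm : 0 < Rmin d t) by now apply Rmin_glb_lt.
  exists (mkposreal _ Hm); simpl; intros h Hh Hsmall.
  pose proof (Rmin_l d t); pose proof (Rmin_r d t).
  assert (Hth : 0 <= t + h) by (apply Rabs_def2 in Hsmall; lra).
  rewrite !extend_eq by lra.
  specialize (Hclose (t + h)); simpl in Hclose; unfold Rdist in Hclose.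
  replace (t + h - t) with h in Hclose by ring.
  apply Hclose; repeat split; [exact Hth | lra | lra].
Qed.

Lemma nonincreasing_from_0 (f df : R -> R) (T : R) :
  0 <= T ->
  (forall t, 0 <= t <= T -> continuity_pt f t) ->
  (forall t, 0 < t -> is_derive f t (df t)) ->
  (forall t, 0 <= t <= T -> df t <= 0) ->
  f T <= f 0.
Proof.
  intros HT Hc Hd Hneg.
  destruct (MVT_gen f 0 T df) as [c [Hcr Heq]];
    rewrite ?Rmin_left, ?Rmax_right in * by lra.
  - intros x Hx; apply Hd; lra.
  - exact Hc.
  - specialize (Hneg c Hcr); nra.
Qed.

(** * A truncated square *)

(** A continuously differentiable function that vanishes exactly on
    [y <= 0]: differentiating it at [w^2 - M^2] only involves the times at
    which [|w| > M]. *)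
Definition possq (y : R) : R := Rmax 0 y ^ 2.

Lemma possq_derive (y : R) : is_derive possq y (2 * Rmax 0 y).
Proof.
  apply is_derive_Reals; intros e He.
  exists (mkposreal e He); simpl; intros h Hh Hsmall.
  (* The first-order remainder is at most [h^2]. *)
  assert (Hrem : Rabs (possq (y + h) - possq y - 2 * Rmax 0 y * h) <= h * h).
  { unfold possq, Rmax; repeat destruct Rle_dec; apply Rabs_le; nra. }
  replace ((possq (y + h) - possq y) / h - 2 * Rmax 0 y)
    with ((possq (y + h) - possq y - 2 * Rmax 0 y * h) / h) by now field.
  apply Rle_lt_trans with (2 := Hsmall).
  unfold Rdiv; rewrite Rabs_mult, Rabs_inv.
  pose proof (Rabs_pos_lt h Hh) as Hpos.
  apply Rmult_le_reg_r with (Rabs h); [exact Hpos|].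
  rewrite Rmult_assoc, Rinv_l, Rmult_1_r by lra.
  rewrite <- Rabs_mult, (Rabs_pos_eq (h * h)) by nra; exact Hrem.
Qed.

Lemma possq_le_0 (y : R) : possq y <= 0 -> y <= 0.
Proof. unfold possq, Rmax; destruct Rle_dec; nra. Qed.

Lemma possq_eq_0 (y : R) : y <= 0 -> possq y = 0.
Proof. intros Hy; unfold possq; rewrite Rmax_left by lra; ring. Qed.

(** * A priori estimates *)

(** The truncated square of [w^2 - M^2] vanishes at time 0 and is
    nonincreasing: where [|w| > M] one has [|u| <= 2 M < 2 |w|], hence
    [w w' <= 0]. *)
Lemma scaled_velocity_bound (alpha : R) (b k U V : R -> R) (T M : R) :
  0 < alpha -> 0 <= T -> 0 <= M ->
  (forall t, 0 <= t <= T ->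
     b t >= 2 * Rabs (k t) * (t + alpha) ^ 2 + 2 / (t + alpha)) ->
  continuity V ->
  (forall t, 0 < t -> is_derive V t (- b t * V t - k t * U t)) ->
  (forall t, 0 <= t <= T -> Rabs (U t) <= 2 * M) ->
  Rabs (alpha ^ 2 * V 0) <= M ->
  Rabs ((T + alpha) ^ 2 * V T) <= M.
Proof.
  intros Ha HT HM Hb HcV HdV HU HM0.
  set (w := fun t => (t + alpha) ^ 2 * V t).
  set (dw := fun t => 2 * (t + alpha) * V t
                      + (t + alpha) ^ 2 * (- b t * V t - k t * U t)).
  set (g := fun t => w t ^ 2 - M ^ 2).
  assert (Hdec : possq (g T) <= possq (g 0)).
  { apply (nonincreasing_from_0 (fun t => possq (g t))
             (fun t => 2 * w t * dw t * (2 * Rmax 0 (g t)))); [exact HT| | |].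
    - intros t _; apply (continuity_pt_comp g possq).
      + unfold g, w; specialize (HcV t); reg.
      + apply derivable_continuous_pt.
        eexists; apply is_derive_Reals, possq_derive.
    - intros t Ht.
      apply (is_derive_comp possq g); [apply possq_derive|].
      unfold g, w; specialize (HdV t Ht); auto_derive.
      + eexists; exact HdV.
      + rewrite (is_derive_unique (fun x : R => V x) _ _ HdV); unfold dw; ring.
    - intros t Ht.
      destruct (Rle_dec (g t) 0) as [Hg|Hg].
      { rewrite (Rmax_left 0) by lra; lra. }
      apply Rnot_le_lt in Hg; rewrite (Rmax_right 0) by lra.
      assert (Hs : 0 < t + alpha) by lra.
      assert (HMw : M <= Rabs (w t)).
      { unfold g in Hg; apply Rsqr_incr_0_var; [|apply Rabs_pos].
        rewrite <- Rsqr_abs; unfold Rsqr; lra. }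
      assert (Hww : w t * dw t <= 0).
      { assert (Heq : w t * dw t = (2 / (t + alpha) - b t) * w t ^ 2
                       + - (k t * U t * w t) * (t + alpha) ^ 2).
        { unfold dw, w; field; lra. }
        assert (Hforce : - (k t * U t * w t) <= 2 * Rabs (k t) * w t ^ 2).
        { apply Rle_trans with (1 := Rle_abs _).
          replace (2 * Rabs (k t) * w t ^ 2)
            with (Rabs (k t) * (2 * Rabs (w t)) * Rabs (w t))
            by (rewrite <- (pow2_abs (w t)); ring).
          rewrite Rabs_Ropp, !Rabs_mult.
          apply Rmult_le_compat_r; [apply Rabs_pos|].
          apply Rmult_le_compat_l; [apply Rabs_pos|].
          specialize (HU t Ht); lra. }
        specialize (Hb t Ht).
        assert (Hdamp : (2 / (t + alpha) - b t) * w t ^ 2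
                        <= - (2 * Rabs (k t) * (t + alpha) ^ 2) * w t ^ 2)
          by (apply Rmult_le_compat_r; [apply pow2_ge_0 | lra]).
        apply Rmult_le_compat_r with (r := (t + alpha) ^ 2) in Hforce;
          [lra | apply pow2_ge_0]. }
      nra. }
  assert (Hg0 : g 0 <= 0).
  { unfold g, w; rewrite Rplus_0_l.
    pose proof (Rabs_pos (alpha ^ 2 * V 0)).
    rewrite <- (pow2_abs (alpha ^ 2 * V 0)); nra. }
  rewrite (possq_eq_0 _ Hg0) in Hdec; apply possq_le_0 in Hdec.
  unfold g in Hdec; fold (w T).
  rewrite <- (pow2_abs (w T)) in Hdec; pose proof (Rabs_pos (w T)); nra.
Qed.

(** [U + M / (t + alpha)] is nonincreasing, because
    [U' <= M / (t + alpha)^2]. *)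
Lemma upper_position_bound (alpha : R) (U V : R -> R) (T M : R) :
  1 <= alpha -> 0 <= T -> 0 <= M ->
  continuity U ->
  (forall t, 0 < t -> is_derive U t (V t)) ->
  (forall t, 0 <= t <= T -> (t + alpha) ^ 2 * V t <= M) ->
  U T <= U 0 + M.
Proof.
  intros Ha HT HM HcU HdU Hw.
  assert (Hdec : U T + M / (T + alpha) <= U 0 + M / (0 + alpha)).
  { apply (nonincreasing_from_0 (fun t => U t + M / (t + alpha))
             (fun t => V t - M / (t + alpha) ^ 2)); [exact HT| | |].
    - intros t Ht; specialize (HcU t); reg; lra.
    - intros t Ht; specialize (HdU t Ht); auto_derive.
      + repeat split; [eexists; exact HdU | lra].
      + rewrite (is_derive_unique (fun x : R => U x) _ _ HdU); field; lra.
    - intros t Ht; specialize (Hw t Ht).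
      assert (Hs : 0 < (t + alpha) ^ 2) by (apply pow_lt; lra).
      enough (V t <= M / (t + alpha) ^ 2) by lra.
      apply Rmult_le_reg_l with (1 := Hs).
      replace ((t + alpha) ^ 2 * (M / (t + alpha) ^ 2)) with M
        by (field; lra).
      exact Hw. }
  assert (0 <= M / (T + alpha)) by (apply Rdiv_le_0_compat; lra).
  assert (M / (0 + alpha) <= M).
  { apply Rmult_le_reg_r with alpha; [lra|].
    replace (M / (0 + alpha) * alpha) with M by (field; lra); nra. }
  lra.
Qed.

Lemma position_bound (alpha : R) (U V : R -> R) (T M : R) :
  1 <= alpha -> 0 <= T -> 0 <= M ->
  continuity U ->
  (forall t, 0 < t -> is_derive U t (V t)) ->
  (forall t, 0 <= t <= T -> Rabs ((t + alpha) ^ 2 * V t) <= M) ->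
  Rabs (U T) <= Rabs (U 0) + M.
Proof.
  intros Ha HT HM HcU HdU Hw.
  assert (Hup : U T <= U 0 + M).
  { apply (upper_position_bound alpha U V); try assumption.
    intros t Ht; apply Rle_trans with (2 := Hw t Ht), Rle_abs. }
  assert (Hlow : - U T <= - U 0 + M).
  { apply (upper_position_bound alpha (fun t => - U t) (fun t => - V t));
      try assumption.
    - now apply continuity_opp.
    - intros t Ht; now apply (is_derive_opp U), HdU.
    - intros t Ht; apply Rle_trans with (2 := Hw t Ht).
      rewrite <- Rabs_Ropp, Ropp_mult_distr_r; apply Rle_abs. }
  revert Hup Hlow; unfold Rabs; repeat destruct Rcase_abs; lra.
Qed.

(** Both estimates are applied on [[0, T]] with the maximum of [|U|] over that
    interval; the factor 1/2 gained on the way from [U] to [w] closes the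
    loop. *)
Lemma a_priori_bound (alpha : R) (b k U V : R -> R) (T : R) :
  1 <= alpha -> 0 <= T ->
  (forall t, 0 <= t ->
     b t >= 2 * Rabs (k t) * (t + alpha) ^ 2 + 2 / (t + alpha)) ->
  continuity U -> continuity V ->
  (forall t, 0 < t -> is_derive U t (V t)) ->
  (forall t, 0 < t -> is_derive V t (- b t * V t - k t * U t)) ->
  Rabs (U T) <= 2 * (Rabs (U 0) + alpha ^ 2 * Rabs (V 0)) /\
  Rabs (V T) <= 2 * (Rabs (U 0) + alpha ^ 2 * Rabs (V 0)).
Proof.
  intros Ha HT Hb HcU HcV HdU HdV.
  destruct (continuity_ab_maj (fun t => Rabs (U t)) 0 T HT)
    as [m [Hmax Hm]].
  { intros t _; apply (continuity_pt_comp U Rabs);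
      [apply HcU | apply Rcontinuity_abs]. }
  set (C := Rabs (U m)) in *.
  assert (Hw0 : Rabs (alpha ^ 2 * V 0) = alpha ^ 2 * Rabs (V 0)).
  { rewrite Rabs_mult, (Rabs_pos_eq (alpha ^ 2)); [ring | nra]. }
  set (W := alpha ^ 2 * Rabs (V 0)) in *.
  assert (HW : 0 <= W) by (rewrite <- Hw0; apply Rabs_pos).
  assert (HC : 0 <= C) by apply Rabs_pos.
  (* The sum is a simpler bound than the maximum of [W] and [C / 2]. *)
  set (M := W + C / 2).
  assert (Hvel : forall t, 0 <= t <= T -> Rabs ((t + alpha) ^ 2 * V t) <= M).
  { intros t Ht.
    apply (scaled_velocity_bound alpha b k U V);
      unfold M; try assumption; try lra.
    - intros r Hr; apply Hb; lra.
    - intros r Hr.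
      assert (Rabs (U r) <= C) by (apply Hmax; lra); lra. }
  assert (HCM : C <= Rabs (U 0) + M).
  { apply (position_bound alpha U V); try assumption; unfold M in *; try lra.
    intros t Ht; apply Hvel; lra. }
  assert (HUT : Rabs (U T) <= C) by (apply Hmax; lra).
  pose proof (Rabs_pos (U 0)) as HU0.
  unfold M in *; split; [lra|].
  specialize (Hvel T (conj HT (Rle_refl T))).
  rewrite Rabs_mult, Rabs_pos_eq in Hvel by nra.
  pose proof (Rabs_pos (V T)).
  assert (1 <= (T + alpha) ^ 2) by nra.
  nra.
Qed.

(** * Stability *)

Lemma large_damping_stable (alpha : R) (b k : R -> R) :
  1 <= alpha ->
  (forall t, 0 <= t ->
     b t >= 2 * Rabs (k t) * (t + alpha) ^ 2 + 2 / (t + alpha)) ->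
  zero_solution_stable b k.
Proof.
  intros Ha Hb eps Heps.
  set (K := 1 + alpha ^ 2).
  assert (HK : 0 < K) by (unfold K; nra).
  exists (eps / (4 * K)).
  assert (Hdelta : 0 < eps / (4 * K)) by (apply Rdiv_lt_0_compat; lra).
  split; [exact Hdelta|].
  set (delta := eps / (4 * K)) in *.
  assert (Heq : eps = 4 * K * delta) by (unfold delta; field; lra).
  intros u du [d2u Hsol] Hinit t Ht.
  destruct (a_priori_bound alpha b k (extend u) (extend du) t)
    as [Hu Hdu]; try assumption.
  - apply extend_continuity, D_in_continuous_on_halfline with du.
    intros r Hr; apply (Hsol r Hr).
  - apply extend_continuity, D_in_continuous_on_halfline with d2u.
    intros r Hr; apply (Hsol r Hr).
  - intros r Hr; rewrite (extend_eq du) by lra.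
    apply D_in_extend; [exact Hr | apply Hsol; lra].
  - intros r Hr; rewrite (extend_eq u), (extend_eq du) by lra.
    destruct (Hsol r) as [_ [Hd2 Hode]]; [lra|].
    replace (- b r * du r - k r * u r) with (d2u r) by lra.
    now apply D_in_extend.
  - rewrite !extend_eq in Hu, Hdu by lra.
    assert (Hu0 : Rabs (u 0) < delta).
    { rewrite <- pow2_abs in Hinit; pose proof (Rabs_pos (u 0)); nra. }
    assert (Hdu0 : Rabs (du 0) < delta).
    { rewrite <- (pow2_abs (du 0)) in Hinit; pose proof (Rabs_pos (du 0)); nra. }
    assert (Hbound : Rabs (u 0) + alpha ^ 2 * Rabs (du 0) < K * delta)
      by (unfold K; nra).
    pose proof (Rabs_pos (u t)); pose proof (Rabs_pos (du t)).
    rewrite <- (pow2_abs (u t)), <- (pow2_abs (du t)).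
    assert (Rabs (u t) < eps / 2) by lra.
    assert (Rabs (du t) < eps / 2) by lra.
    nra.
Qed.

Theorem mainTheorem5 (k : R -> R) (hk : continuous_on_halfline k) :
  (exists b : R -> R, continuous_on_halfline b /\ zero_solution_stable b k) /\
  (forall alpha : R, 1 < alpha ->
   forall b : R -> R, continuous_on_halfline b ->
     (forall t : R, 0 <= t ->
        b t >= 2 * Rabs (k t) * (t + alpha) ^ 2 + 2 / (t + alpha)) ->
     zero_solution_stable b k).
Proof.
  split.
  - (* On the half-line this is the bound for [alpha = 2]; the extension
       makes it continuous on the whole line. *)
    exists (extend (fun t => 2 * Rabs (k t) * (t + 2) ^ 2 + 2 / (t + 2))).
    split.
    + apply continuity_continuous_on_halfline.
      change (continuity (fun t => 2 * Rabs (extend k t) * (Rmax 0 t + 2) ^ 2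
                                   + 2 / (Rmax 0 t + 2))).
      pose proof (extend_continuity k hk) as Hk.
      assert (Hmax : continuity (Rmax 0)).
      { apply (extend_continuity (fun t => t)).
        apply continuity_continuous_on_halfline, derivable_continuous,
          derivable_id. }
      intros t; specialize (Hk t); specialize (Hmax t).
      pose proof (Rmax_l 0 t); reg; lra.
    + apply large_damping_stable with 2; [lra|].
      intros t Ht; rewrite extend_eq by exact Ht; apply Rge_refl.
  - intros alpha Ha b _ Hb; apply large_damping_stable with alpha;
      [lra | exact Hb].
Qed.
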